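(* Let $\beta\in(0,1]$, $R>0$, $n\ge1$. In the Poisson point process model with intensity $\lambda_g(x,y)=n\mathbf 1(y\ge g(x))$ on $[0,1]\times\mathbb R$, the nonparametric maximum-likelihood estimator $(\hat g^{MLE}(x),x\in[0,1])$, $$\hat g^{MLE}(x)=\min_{j\ge1}\big(Y_j+R|x-X_j|^\beta\big),$$ is a sufficient and complete statistic for the parameter class $g\in\mathcal C^\beta(R)$.
   Context: $\mathcal C^{\beta}(R)=\{f:[0,1]\to\mathbb R \mid |f(y)-f(x)|\le R|y-x|^\beta\ \forall x,y\in[0,1]\}$. Under $P_g$ (expectation $\mathbb E_g$) one observes the points $(X_j,Y_j)_{j\ge1}$ of a Poisson point process on $[0,1]\times\mathbb R$ with intensity $\lambda_g$. The statistic $\hat g^{MLE}$ takes values in $\mathcal C^\beta(R)$, equipped with the Borel $\sigma$-algebra of the uniform (supremum) norm, which is the one generated by point evaluations. Sufficiency and completeness are with respect to the family $\{P_g: g\in\mathcal C^\beta(R)\}$; completeness means: if $T:\mathcal C^\beta(R)\to\mathbb R$ is measurable with $\mathbb E_g[T(\hat g^{MLE})]=0$ for all $g\in\mathcal C^\beta(R)$, then $T(\hat g^{MLE})=0$ $P_g$-a.s. for all $g\in\mathcal C^\beta(R)$. *)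

(* Defs.v *)
From HB Require Import structures.
From mathcomp Require Import all_boot all_order all_algebra.
From mathcomp Require Import all_classical all_reals all_analysis.
From mathcomp Require Import measurable_realfun.

Set Implicit Arguments.
Unset Strict Implicit.
Unset Printing Implicit Defensive.

Import Order.TTheory GRing.Theory Num.Theory.
Import numFieldNormedType.Exports.

Local Open Scope classical_set_scope.
Local Open Scope ring_scope.

(* The Hoelder ball C^beta(L).  A function on [0, 1] is encoded by its
   extension by 0 to the real line, so that two elements of the record are equal
   exactly when they agree on [0, 1]. *)
Record holderBall (R : realType) (beta : R) (L : {posnum R}) := HolderBall {
  holder_fun :> R -> R ;
  holder_funP : forall x y, 0 <= x <= 1 -> 0 <= y <= 1 ->
    `|holder_fun y - holder_fun x| <= L%:num * `|y - x| `^ beta ;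
  holder_fun_out : forall x, ~~ (0 <= x <= 1) -> holder_fun x = 0 }.

Section holder_ball_structures.
Context (R : realType) (beta : R) (L : {posnum R}).
Local Notation ball := (holderBall beta L).

Let zeroP (x y : R) : 0 <= x <= 1 -> 0 <= y <= 1 ->
  `|(0 : R) - 0| <= L%:num * `|y - x| `^ beta.
Proof. by move=> _ _; rewrite subrr normr0 mulr_ge0 ?powR_ge0. Qed.

HB.instance Definition _ := gen_eqMixin ball.
HB.instance Definition _ := gen_choiceMixin ball.
HB.instance Definition _ := isPointed.Build ball
  (@HolderBall R beta L (fun=> 0) zeroP (fun _ _ => erefl)).

Definition to_uniform (f : ball) : {uniform` `[0, 1]%classic -> R} :=
  holder_fun f.

(* topology of the supremum norm on [0, 1], and its Borel sigma-algebra *)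
HB.instance Definition _ := Topological.copy ball (initial_topology to_uniform).
HB.instance Definition _ := Measurable.copy ball
  (g_sigma_algebraType (@open ball)).

End holder_ball_structures.

Section point_process.
Context {d dE} {T : measurableType d} {E : measurableType dE} {R : realType}.
Local Open Scope ereal_scope.

(* N(A) = sum_j delta_(Z_j)(A), the number of points in A *)
Definition point_count (Z : nat -> T -> E) (A : set E) (w : T) : \bar R :=
  \sum_(0 <= j <oo) \d_(Z j w) A.

(* For a finite mean r, the Poisson weights are written out because the library
   function poisson_pmf takes the value 1 at r = 0 for every k.  Independence
   for all finite subfamilies is the case where some of the B i are setT. *)
Definition is_poisson_process (P : probability T R) (Z : nat -> T -> E)
    (mu : set E -> \bar R) : Prop :=
  [/\ forall A (r : R) (k : nat), measurable A -> mu A = r%:E ->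
        P [set w | point_count Z A w = k%:R%:E] =
        (expR (- r) * r ^+ k / k`!%:R)%:E,
      forall A, measurable A -> mu A = +oo ->
        P [set w | point_count Z A w = +oo] = 1 &
      forall (m : nat) (A : 'I_m -> set E) (B : 'I_m -> set (\bar R)),
        (forall i, measurable (A i)) -> trivIset setT A ->
        (forall i, measurable (B i)) ->
        P [set w | forall i, B i (point_count Z (A i) w)] =
        \prod_(i < m) P [set w | B i (point_count Z (A i) w)]].

(* The sigma-algebra of the observed point process.  It is generated by the
   counts, so it does not see the (arbitrary) numbering of the points. *)
Definition point_process_events (Z : nat -> T -> E) : set (set T) :=
  <<s [set V | exists (A : set E) (B : set (\bar R)),
         [/\ measurable A, measurable B &
             V = [set w | B (point_count Z A w)]]] >>.

End point_process.
Arguments point_process_events {d dE T E} R Z.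

Section statistics.
Context {d dS} {T : measurableType d} {S : measurableType dS} {R : realType}.
Context {Theta : Type}.
Local Open Scope ereal_scope.
Implicit Types (P : Theta -> probability T R) (F : set (set T)) (s : T -> S).

Definition is_statistic F s : Prop :=
  forall B, measurable B -> F (s @^-1` B).

(* k o s is a version of the conditional probability Q(V | s) *)
Definition is_cond_prob (Q : probability T R) s (V : set T) (k : S -> R) :
    Prop :=
  [/\ measurable_fun setT k,
      Q.-integrable setT (fun w => (k (s w))%:E) &
      forall B, measurable B ->
        \int[Q]_(w in s @^-1` B) (k (s w))%:E = Q (V `&` s @^-1` B)].

Definition is_sufficient P F s : Prop :=
  forall V, F V -> exists k : S -> R, forall theta, is_cond_prob (P theta) s V k.

Definition is_complete P s : Prop :=
  forall f : S -> R, measurable_fun setT f ->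
    (forall theta, (P theta).-integrable setT (fun w => (f (s w))%:E)) ->
    (forall theta, 'E_(P theta)[fun w => f (s w)] = 0) ->
    forall theta, {ae P theta, forall w, f (s w) = 0%R}.

End statistics.

Section boundary_model.
Context (R : realType) (beta : R) (L : {posnum R}).
Local Notation ball := (holderBall beta L).

Definition intensity (n : nat) (g : ball) (z : R * R) : R :=
  n%:R * (g z.1 <= z.2)%R%:R.

Definition intensity_measure (n : nat) (g : ball) (A : set (R * R)) : \bar R :=
  (\int[lebesgue_measure \x lebesgue_measure]_(z in
     A `&` (`[0%R, 1%R]%classic `*` setT)) (intensity n g z)%:E)%E.

Definition cusp (z : R * R) (x : R) : R :=
  z.2 + L%:num * `|x - z.1| `^ beta.

(* The infimum is the minimum as soon as the latter exists (lemma mle_fun_min),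
   which is almost surely the case in the model.  If the cusps are not bounded
   below, inf is 0 by convention, at every x. *)
Definition mle_fun (z : nat -> R * R) (x : R) : R :=
  if 0 <= x <= 1 then inf (range (fun j => cusp (z j) x)) else 0.

Lemma mle_fun_min z x j0 : 0 <= x <= 1 ->
  (forall j, cusp (z j0) x <= cusp (z j) x) -> mle_fun z x = cusp (z j0) x.
Proof.
move=> x01 minj; rewrite /mle_fun x01; apply/eqP; rewrite eq_le; apply/andP.
split; last by apply: lb_le_inf; [exists (cusp (z j0) x), j0|move=> _ [j _ <-]].
by apply: ge_inf; [exists (cusp (z j0) x) => _ [j _ <-]|exists j0].
Qed.

Hypothesis beta01 : 0 < beta <= 1.

Lemma powR_subadd (a b : R) : 0 <= a -> 0 <= b ->
  (a + b) `^ beta <= a `^ beta + b `^ beta.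
Proof.
case/andP: beta01 => b0 b1 a0 c0.
have [s0|s0] := leP (a + b) 0.
  have /eqP : a + b == 0 by rewrite eq_le s0 addr_ge0.
  by move=> ->; rewrite powR0 ?gt_eqF// addr_ge0// powR_ge0.
have key c : 0 <= c -> c <= a + b ->
    c / (a + b) * (a + b) `^ beta <= c `^ beta.
  move=> cge0 cle.
  have [->|cN0] := eqVneq c 0; first by rewrite !mul0r powR_ge0.
  have cp : 0 < c by rewrite lt_def cN0.
  rewrite -{2}(divfK (lt0r_neq0 s0) c) powRM ?divr_ge0 ?(ltW s0)//.
  rewrite ler_wpM2r ?powR_ge0// ger1_powR//.
  by rewrite divr_gt0// ler_pdivrMr// mul1r.
apply: le_trans (lerD (key a a0 _) (key b c0 _)); rewrite ?lerDl ?lerDr//.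
by rewrite -mulrDl -mulrDl divff ?mul1r// gt_eqF.
Qed.

Lemma cusp_holder z x y :
  cusp z x <= cusp z y + L%:num * `|y - x| `^ beta.
Proof.
rewrite /cusp -addrA lerD2l -mulrDr ler_wpM2l//.
apply: le_trans (powR_subadd _ _) => //.
case/andP: beta01 => b0 _.
rewrite ge0_ler_powR ?nnegrE ?addr_ge0 ?(ltW b0)//.
by rewrite [leRHS]addrC [`|y - x|]distrC ler_distD.
Qed.

Lemma mle_fun_holder z x y : 0 <= x <= 1 -> 0 <= y <= 1 ->
  `|mle_fun z y - mle_fun z x| <= L%:num * `|y - x| `^ beta.
Proof.
move=> x01 y01; rewrite /mle_fun x01 y01.
pose S u := range (fun j => cusp (z j) u); rewrite -!/(S _).
have S0 u : S u !=set0 by exists (cusp (z 0%N) u), 0%N.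
have lb u v : has_lbound (S u) -> has_lbound (S v).
  move=> [m mS]; exists (m - L%:num * `|v - u| `^ beta) => _ [j _ <-].
  by rewrite lerBlDr (le_trans _ (cusp_holder _ u v))//; apply: mS; exists j.
have [lx|nlx] := pselect (has_lbound (S x)); last first.
  rewrite !inf_out ?subrr ?normr0 ?mulr_ge0 ?powR_ge0//; first by case.
  by case=> _ /lb.
have le u v : has_lbound (S u) ->
    inf (S u) <= inf (S v) + L%:num * `|v - u| `^ beta.
  move=> lu; rewrite -lerBlDr; apply: lb_le_inf => // _ [j _ <-].
  rewrite lerBlDr (le_trans _ (cusp_holder _ u v))//.
  by apply: ge_inf => //; exists j.
rewrite ler_distl lerBlDr le//= addrC distrC addrC le//; exact: lb lx.
Qed.

Lemma mle_fun_out z x : ~~ (0 <= x <= 1) -> mle_fun z x = 0.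
Proof. by rewrite /mle_fun => /negbTE ->. Qed.

Definition mle (z : nat -> R * R) : ball :=
  HolderBall (mle_fun_holder z) (mle_fun_out z).

End boundary_model.

(* Main.v *)
(* Given g and h, the intensities n 1(y >= g(x)) and n 1(y >= h(x)) coincide off
   the set D of points lying strictly below g or below h.  By independence of
   the counts over disjoint sets, P_g and P_h restricted to the event {no point
   in D} are therefore proportional on the sigma-algebra of the observations.
   Almost surely under P_g, this event is {ghat >= h}: no observation lies below
   h if and only if ghat >= h on [0, 1], because h is itself Hoelder.  Hence
     P_g (V /\ {ghat >= h}) = a(g, h) P_h (V /\ {ghat >= g}),
   so that the family behaves as a truncation family in ghat.
   Sufficiency: on {ghat >= -l} all conditional probabilities given ghat agree
   with those of P_{-l}; they are glued over l.
   Completeness: if E_h f(ghat) = 0 for all h, then f(ghat) integrates to 0 over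
   every {ghat >= g}; these events form a pi-system (maxima of Hoelder functions
   are Hoelder) which generates the Borel sigma-algebra, since {ghat(x) >= c} is
   {ghat >= c - R |. - x|^beta}. *)

From HB Require Import structures.
Require Import Defs.
From mathcomp Require Import all_boot all_order all_algebra.
From mathcomp Require Import all_classical all_reals all_analysis.
From mathcomp Require Import measurable_realfun.
From mathcomp Require Import ring lra.

Set Implicit Arguments.
Unset Strict Implicit.
Unset Printing Implicit Defensive.

Import Order.TTheory GRing.Theory Num.Theory.
Import numFieldNormedType.Exports.

Local Open Scope classical_set_scope.
Local Open Scope ring_scope.

(** * Truncation families *)

Lemma measurable_preimage d dS (T : measurableType d) (S : measurableType dS)
    (s : T -> S) (A : set S) :
  measurable_fun setT s -> measurable A -> measurable (s @^-1` A).
Proof. by move=> ms mA; rewrite -[_ @^-1` _]setTI; exact: ms. Qed.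

Lemma measure_setI_null d (T : measurableType d) (R : realType)
    (m : {measure set T -> \bar R}) (A B : set T) :
  measurable B -> measurable A -> m (~` B) = 0%E -> m A = m (A `&` B).
Proof.
move=> mB mA mB0.
rewrite (measureDI m mA mB) (@subset_measure0 _ _ _ m _ (~` B)) ?add0e//.
- exact: measurableD.
- exact: measurableC.
Qed.

Section finite_pushforward.
Context {d dS} {T : measurableType d} {S : measurableType dS} {R : realType}.
Local Open Scope ereal_scope.
Variables (m : {finite_measure set T -> \bar R}) (s : T -> S).
Hypothesis ms : measurable_fun setT s.

Let push (A : set S) := m (s @^-1` A).

Let push0 : push set0 = 0.
Proof. by rewrite /push preimage_set0 measure0. Qed.

Let push_ge0 A : 0 <= push A.
Proof. exact: measure_ge0. Qed.

Let push_sigma_additive : semi_sigma_additive push.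
Proof.
move=> F mF tF mUF; rewrite /push preimage_bigcup.
apply: measure_semi_sigma_additive.
- by move=> n; exact: measurable_preimage.
- apply/trivIsetP => /= i j _ _ ij; rewrite -preimage_setI.
  by move/trivIsetP : tF => /(_ _ _ _ _ ij) ->//; rewrite preimage_set0.
- by rewrite -preimage_bigcup; exact: measurable_preimage.
Qed.

HB.instance Definition _ := isMeasure.Build _ _ _ push
  push0 push_ge0 push_sigma_additive.

Let push_fin : fin_num_fun push.
Proof. by move=> A mA; apply: fin_num_measure; exact: measurable_preimage. Qed.

HB.instance Definition _ := Measure_isFinite.Build _ _ _ push push_fin.

(** The image measure comes as an existential statement so that one law per parameter can be picked
    by choice. Its finiteness is kept for the Radon-Nikodym derivatives taken between such laws. *)
Lemma finite_pushforward : exists mu : {finite_measure set S -> \bar R},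
  forall A, mu A = m (s @^-1` A).
Proof. by exists push. Qed.

End finite_pushforward.

Lemma integral_law d dS (T : measurableType d) (S : measurableType dS)
    (R : realType) (P : probability T R) (s : T -> S)
    (mu : {measure set S -> \bar R}) (f : S -> \bar R) (B : set S) :
  measurable_fun setT s -> (forall A, mu A = P (s @^-1` A)) ->
  measurable B -> measurable_fun setT f ->
  (forall x, 0 <= f x)%E \/ P.-integrable setT (f \o s) ->
  (\int[P]_(w in s @^-1` B) f (s w) = \int[mu]_(x in B) f x)%E.
Proof.
move=> ms muE mB mf f0i.
transitivity (\int[pushforward P s]_(x in B) f x)%E; last first.
  by apply: eq_measure_integral => A _ _; rewrite [RHS]muE.
case: f0i => [f0|fi].
  by rewrite ge0_integral_pushforward//; exact: measurable_funTS.
rewrite integral_pushforward//.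
by apply: (integrableS measurableT) => //; exact: measurable_preimage.
Qed.

(* The density of P theta with respect to P eta depends on the sample only
   through s, and is constant on the intersection of the (almost sure) supports
   s @^-1` supp theta and s @^-1` supp eta. *)
Section truncation_family.
Context {d dS} {T : measurableType d} {S : measurableType dS} {R : realType}.
Context {Theta : Type}.
Local Open Scope ereal_scope.
Variables (P : Theta -> probability T R) (F : set (set T)) (s : T -> S).
Variable supp : Theta -> set S.
Hypothesis Fm : F `<=` measurable.
Hypothesis FI : setI_closed F.
Hypothesis Fs : is_statistic F s.
Hypothesis msupp : forall theta, measurable (supp theta).
Hypothesis suppP : forall theta, P theta (s @^-1` ~` supp theta) = 0.
Hypothesis truncation : forall theta eta, exists a : {nonneg R},
  forall V, F V ->
    P theta (V `&` s @^-1` supp eta) =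
    a%:num%:E * P eta (V `&` s @^-1` supp theta).

Lemma measurable_statistic : measurable_fun setT s.
Proof. by move=> _ B mB; rewrite setTI; apply/Fm/Fs. Qed.
Let ms := measurable_statistic.

Lemma truncation_law (mu : Theta -> {finite_measure set S -> \bar R})
    (theta eta : Theta) (a : {nonneg R}) (A : set S) :
  (forall theta A, mu theta A = P theta (s @^-1` A)) ->
  (forall V, F V -> P theta (V `&` s @^-1` supp eta) =
    a%:num%:E * P eta (V `&` s @^-1` supp theta)) ->
  measurable A -> A `<=` supp theta -> A `<=` supp eta ->
  mu theta A = mscale a (mu eta) A.
Proof.
move=> muE aE mA At Ae.
have sub xi : A `<=` supp xi -> s @^-1` A `&` s @^-1` supp xi = s @^-1` A.
  by move=> Axi; apply: setIidl => w; exact: Axi.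
rewrite [LHS]muE -(sub eta Ae) aE; last exact: Fs.
by rewrite (sub theta At) -muE.
Qed.

(** The vanishing of all expectations of [f] makes [f] integrate to 0 over every support. The
    supports form a generating pi-system, so [f] integrates to 0 over every measurable set and is
    null almost everywhere. *)
Lemma truncation_complete :
  (forall theta eta, exists xi, supp theta `&` supp eta = supp xi) ->
  @measurable _ S = <<s range supp >> ->
  is_complete P s.
Proof.
move=> suppI Sgen f mf fi Ef theta.
have /choice[mu muE] : forall theta,
  exists m : {finite_measure set S -> \bar R}, forall A, m A = P theta (s @^-1` A).
  by move=> t; exact: finite_pushforward.
have mEf : measurable_fun setT (EFin \o f) by exact/measurable_EFinP.
have fmu t : (mu t).-integrable setT (EFin \o f).
  apply/integrableP; split => //.
  have := fi t => /integrableP[_]; apply: le_lt_trans.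
  rewrite -[X in \int[P t]_(x in X) _](preimage_setT s).
  have mabs : measurable_fun setT (abse \o (EFin \o f)).
    exact: measurableT_comp.
  have -> // := integral_law ms (muE t) measurableT mabs.
  by left => x; exact: abse_ge0.
have fmuS t A : measurable A -> (mu t).-integrable A (EFin \o f).
  by move=> mA; exact: (integrableS measurableT mA (@subsetT _ _) (fmu t)).
have muC t : mu t (~` supp t) = 0 by rewrite muE.
have intS t A : measurable A ->
    \int[mu t]_(x in A) (f x)%:E = \int[mu t]_(x in A `&` supp t) (f x)%:E.
  move=> mA; rewrite (negligible_integral _ _ _ (muC t))//.
  - by rewrite setDE setCK.
  - exact: measurableC.
  - exact: fmuS.
have int0 t : \int[mu t]_x (f x)%:E = 0.
  have := Ef t; rewrite unlock => <-.
  rewrite -[X in \int[P t]_(x in X) _](preimage_setT s).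
  by have -> // := integral_law ms (muE t) measurableT mEf; right; exact: fi.
(* Only [supp t]&[supp theta], itself some [supp xi], contributes. There [mu theta] is a multiple of
   [mu xi], and [mu xi] is carried by [supp xi], so the integral is a multiple of the full
   expectation under [xi]. *)
have int_supp t : \int[mu theta]_(x in supp t) (f x)%:E = 0.
  rewrite intS//; have [xi suppE] := suppI t theta.
  rewrite suppE; have [a aE] := truncation theta xi.
  rewrite (eq_measure_integral (mscale a (mu xi))); last first.
    move=> A mA Axi; apply: truncation_law => //.
    by move=> x /Axi; rewrite -suppE => -[].
  (* The factor [a] is extracted for nonnegative functions, then used on the positive and negative
     parts of [f]; integrability makes their difference meaningful. *)
  have abs0 (h : S -> \bar R) : measurable_fun setT h -> (forall x, 0 <= h x) ->
      \int[mscale a (mu xi)]_(x in supp xi) h x =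
      a%:num%:E * \int[mu xi]_x h x.
    move=> mh h0; rewrite ge0_integral_mscale//; last exact: measurable_funTS.
    rewrite [in RHS](ge0_negligible_integral _ _ _ _ (muC xi))//.
    - by rewrite setDE setCK setTI.
    - exact: measurableC.
  rewrite integralE (abs0 _ (measurable_funepos mEf) (funepos_ge0 _)).
  rewrite (abs0 _ (measurable_funeneg mEf) (funeneg_ge0 _)).
  rewrite -muleBr//; last first.
    by apply: fin_num_adde_defr; exact/integrable_pos_fin_num/fmu.
  by rewrite -integralE int0 mule0.
have int_all A : measurable A -> \int[mu theta]_(x in A) (f x)%:E = 0.
  move=> mA; apply: (@dynkin_induction _ _ (range supp)
    (fun A => \int[mu theta]_(x in A) (f x)%:E = 0)) => //.
  - move=> _ _ [t _ <-] [t' _ <-]; have [xi ->] := suppI t t'.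
    by exists xi.
  - by move=> _ [t _ <-]; exact: int_supp.
  - move=> B mB B0; have := int0 theta.
    rewrite -(setvU B) integral_setU//.
    + by rewrite B0 adde0.
    + exact: measurableC.
    + by apply: measurable_funTS.
    + by rewrite disj_set2E setICl.
  - move=> B mB tB B0; have mUB := bigcupT_measurable _ mB.
    by rewrite (integral_bigcup tB mB (fmuS _ _ mUB)) eseries0.
  - by rewrite -Sgen.
have ae0 : ae_eq (mu theta) setT (EFin \o f) (cst 0).
  apply: integral_ae_eq => //; first exact: fmu.
  by move=> A _ mA; rewrite int_all// integral0.
case: ae0 => N [mN N0 fN]; exists (s @^-1` N); split.
- exact: measurable_preimage.
- by rewrite -muE.
- move=> w /= fw; apply: fN => /= /(_ I) [] f0; exact: fw.
Qed.

(** On [cell l] the version of the conditional probability of [V] is the one computed under [eta l].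
    It serves every [theta]: passing from [eta l] to [theta] multiplies the law of [s] and its
    restriction to [V] by the same constant, which leaves their density unchanged. *)
Lemma truncation_sufficient (cell : nat -> set S) (eta : nat -> Theta) :
  (forall l, measurable (cell l)) -> trivIset setT cell ->
  \bigcup_l cell l = setT -> (forall l, cell l `<=` supp (eta l)) ->
  is_sufficient P F s.
Proof.
move=> mcell tcell cellT cell_supp V FV.
have /choice[mu muE] : forall theta,
  exists m : {finite_measure set S -> \bar R}, forall A, m A = P theta (s @^-1` A).
  by move=> t; exact: finite_pushforward.
have /choice[nu nuE] : forall theta,
  exists m : {finite_measure set S -> \bar R}, forall A, m A = P theta (s @^-1` A `&` V).
  by move=> t; exact: (finite_pushforward (mrestr (P t) (Fm FV)) ms).
have numu l : nu (eta l) `<< mu (eta l).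
  apply/null_content_dominatesP => A mA muA0.
  have A0 : P (eta l) (s @^-1` A) = 0 by rewrite -muE.
  suff : P (eta l) (s @^-1` A `&` V) = 0 by rewrite -nuE.
  apply: subset_measure0 A0 => //.
  - by apply: measurableI; [exact: measurable_preimage|exact: Fm].
  - exact: measurable_preimage.
(* [k_ l] is the conditional probability of [V] given [s] under [eta l], as the density of
   [nu (eta l)] with respect to [mu (eta l)]. *)
have /choice[k_ /all_and4[k_ge0 k_fin ki kE]] l :=
  radon_nikodym_sigma_finite (numu l).
have /choice[idx idxP] x : exists l, cell l x.
  by have : setT x by []; rewrite -cellT => -[l _]; exists l.
have idxE l x : cell l x -> idx x = l.
  by move=> lx; apply: (tcell (idx x) l) => //; exists x; split.
pose k x := fine (k_ (idx x) x).
have kEk l x : cell l x -> (k x)%:E = k_ l x.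
  by move=> /idxE; rewrite /k => ->; rewrite fineK.
have k0 x : 0 <= (k x)%:E by rewrite (kEk _ _ (idxP x)).
have mk : measurable_fun setT k.
  rewrite -cellT; apply/measurable_fun_bigcup => // l.
  apply: (eq_measurable_fun (fine \o k_ l)).
    by move=> x /set_mem /idxE; rewrite /k => ->.
  by apply: measurable_funTS; apply: measurableT_comp => //;
    exact/measurable_int/ki.
have mEk : measurable_fun setT (EFin \o k) by exact/measurable_EFinP.
have int_cell theta l C : measurable C -> C `<=` cell l -> C `<=` supp theta ->
    \int[mu theta]_(x in C) (k x)%:E = nu theta C.
  move=> mC Cl Ct; have Ce := subset_trans Cl (@cell_supp l).
  have [a aE] := truncation theta (eta l).
  rewrite (eq_measure_integral (mscale a (mu (eta l)))); last first.
    by move=> A mA AC; apply: truncation_law => // x /AC; [exact: Ct|exact: Ce].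
  rewrite ge0_integral_mscale//; last exact: measurable_funTS.
  rewrite (eq_integral (k_ l)) -?kE//; last first.
    by move=> x /set_mem /Cl; exact: kEk.
  have FC : F (V `&` s @^-1` C) by apply: FI => //; exact: Fs.
  have sub xi : C `<=` supp xi ->
      V `&` s @^-1` C `&` s @^-1` supp xi = s @^-1` C `&` V.
    by move=> Cxi; rewrite setIC [V `&` _]setIC; apply: setIidr => w [/Cxi].
  by have := aE _ FC; rewrite !sub// -!nuE.
have intk theta B : measurable B ->
    \int[P theta]_(w in s @^-1` B) (k (s w))%:E = P theta (V `&` s @^-1` B).
  move=> mB.
  have -> // := integral_law ms (muE theta) mB mEk; last by left.
  have mC : measurable (~` supp theta) by exact: measurableC.
  have BC : B `&` supp theta = \bigcup_l (B `&` supp theta `&` cell l).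
    by rewrite -setI_bigcupr cellT setIT.
  have mBC l : measurable (B `&` supp theta `&` cell l).
    by apply: measurableI => //; exact: measurableI.
  have tBC : trivIset setT (fun l => B `&` supp theta `&` cell l).
    exact: trivIset_setIl.
  (* Both [mu theta] and [nu theta] vanish outside [supp theta], so [B] may be cut down to it and
     then split along the cells. *)
  transitivity (nu theta (B `&` supp theta)); last first.
    rewrite nuE setIC preimage_setI setIA.
    rewrite [RHS](measure_setI_null (measurable_preimage ms (msupp theta)))//.
      by apply: measurableI; [exact: Fm|exact: measurable_preimage].
    by rewrite preimage_setC; exact: suppP.
  have muC : mu theta (~` supp theta) = 0 by rewrite muE; exact: suppP.
  rewrite (ge0_negligible_integral mC mB (measurable_funTS mEk)
    (fun x _ => k0 x) muC)//.
  rewrite setDE setCK BC (ge0_integral_bigcup _ mBC (measurable_funTS mEk)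
    (fun x _ => k0 x) tBC)//.
  transitivity (\sum_(l <oo) nu theta (B `&` supp theta `&` cell l)); last first.
    by rewrite measure_bigcup//; apply: eq_eseriesl => l; rewrite in_setT.
  apply: eq_eseriesr => l _.
  by apply: (int_cell theta l); [exact: mBC|move=> x [_ xl]|move=> x [[_ xt] _]].
exists k => theta; split => //; last exact: intk.
apply/integrableP; split; first exact: (measurableT_comp mEk ms).
under eq_integral do rewrite gee0_abs//.
rewrite -[X in \int[P theta]_(x in X) _](preimage_setT s) intk//.
by rewrite preimage_setT setIT (le_lt_trans (probability_le1 _ (Fm FV)))// ltry.
Qed.

End truncation_family.

(** * Void probabilities of Poisson processes *)

Section point_count.
Context {d dE} {T : measurableType d} {E : measurableType dE} {R : realType}.
Local Open Scope ereal_scope.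
Variable Z : nat -> T -> E.
Implicit Types (A B : set E) (w : T).

Local Notation N := (@point_count d dE T E R Z).

Lemma point_count_eq0 A w : (N A w == 0) = `[< forall j, ~ A (Z j w) >].
Proof.
apply/eqP/asboolP => [N0 j Aj|A0]; last first.
  rewrite /point_count eseries0// => j _ _.
  by rewrite diracE memNset//; exact: A0.
have : \sum_(0 <= i < j.+1) (\d_(Z i w) A : \bar R) <= N A w.
  exact: nneseries_lim_ge.
rewrite N0; apply/negP; rewrite -ltNge big_nat_recr//= diracE mem_set//.
by rewrite (lt_le_trans (@lte01 R))// leeDr// sume_ge0.
Qed.

(** The partial sums are a nondecreasing sequence of integers: if bounded they are eventually
    constant at their maximum, otherwise they tend to infinity. *)
Lemma point_count_nat A w : (exists k : nat, N A w = k%:R%:E) \/ N A w = +oo.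
Proof.
pose u j : nat := (\sum_(0 <= i < j) (Z i w \in A))%N.
have uE j : \sum_(0 <= i < j) (\d_(Z i w) A : \bar R) = (u j)%:R%:E.
  rewrite /u natr_sum -sumEFin; apply: eq_bigr => i _.
  by rewrite diracE.
have u_le i j : (i <= j)%N -> (u i <= u j)%N.
  by move=> ij; rewrite /u [leqRHS](big_cat_nat (n := i))//= leq_addr.
have [[m um]|nbd] := pselect (exists m, forall j, (u j <= m)%N).
  left.
  (* Induction on the bound: either [m.+1] is attained and is the maximum, or [m] is already a
     bound. *)
  have [M [k uk] Mmax] : exists2 M, exists k, u k = M & forall j, (u j <= M)%N.
    elim: m um => [|m IH] um; first exists 0%N => //.
      by exists 0%N; rewrite /u big_geq.
    have [[k uk]|nk] := pselect (exists k, u k = m.+1).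
      by exists m.+1 => //; exists k.
    apply: IH => j; have := um j; rewrite leq_eqVlt => /orP[/eqP uj|//].
    by case: nk; exists j.
  exists M; apply/cvg_lim => //; apply: cvg_near_cst.
  exists k => // j /= kj; rewrite uE; congr (_%:R%:E); apply/eqP.
  by rewrite eqn_leq Mmax -uk u_le.
right; apply/eqyP => r _.
have [k rk] : exists k, (r <= (u k)%:R)%R.
  apply: contra_notP nbd => nk; exists (Num.truncn r) => j.
  rewrite -ltnS -(ltr_nat R) (lt_le_trans _ (ltW (truncnS_gt _)))//.
  by rewrite ltNge; apply/negP => rj; apply: nk; exists j.
apply: (@le_trans _ _ (u k)%:R%:E); first by rewrite lee_fin.
by rewrite -uE; exact: nneseries_lim_ge.
Qed.

Lemma point_count_partition (I : finType) (phi : E -> I) A w :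
  N A w = \sum_i N (A `&` phi @^-1` [set i]) w.
Proof.
rewrite /point_count -nneseries_sum//; apply: eq_eseriesr => j _.
rewrite (bigD1 (phi (Z j w)))//= big1 ?adde0 => [|i /eqP ni].
  rewrite !diracE; congr (_%:R%:E); congr nat_of_bool.
  by apply/idP/idP => /set_mem H; apply/mem_set; [split|case: H].
by rewrite diracE memNset// => -[_ /= /esym].
Qed.

Hypothesis mZ : forall j, measurable_fun setT (Z j).

Lemma measurable_point_count A : measurable A -> measurable_fun setT (N A).
Proof.
move=> mA; apply: ge0_emeasurable_sum => // j _.
apply: (@eq_measurable_fun _ _ _ _ _ (EFin \o (\1_A \o Z j))) => //.
apply/measurable_EFinP; apply: measurableT_comp => //.
Qed.

End point_count.

(** Every preimage under [kappa] is a countable disjoint union of fibers. They are enumerated by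
    their codes in [nat], with [set0] at codes of no element of [C]. *)
Lemma measure_countable_fibers d (T : measurableType d) (R : realType)
    (K : countType) (kappa : T -> K) (m m' : {measure set T -> \bar R}) :
  (forall k, measurable (kappa @^-1` [set k])) ->
  (forall k, m (kappa @^-1` [set k]) = m' (kappa @^-1` [set k])) ->
  forall C, measurable (kappa @^-1` C) /\ m (kappa @^-1` C) = m' (kappa @^-1` C).
Proof.
move=> mk mm' C.
pose F n := if @pickle_inv K n is Some k then
  if k \in C then kappa @^-1` [set k] else set0 else set0.
have mF n : measurable (F n).
  by rewrite /F; case: pickle_inv => // k; case: ifP.
have FC : kappa @^-1` C = \bigcup_n F n.
  apply/seteqP; split => [w Cw|w [n _]]; last first.
    rewrite /F; case: pickle_inv => // k; case: ifPn => // /set_mem Ck /= kw.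
    by rewrite /= kw.
  by exists (pickle (kappa w)) => //; rewrite /F pickleK_inv mem_set.
have tF : trivIset setT F.
  apply/trivIsetP => i j _ _ ij; apply/seteqP; split => // w []; rewrite /F.
  case Ei : (@pickle_inv K i) => [k|//]; case: ifP => // _ /= kw.
  case Ej : (@pickle_inv K j) => [l|//]; case: ifP => // _ /= lw.
  have := @pickle_invK K i; have := @pickle_invK K j.
  rewrite Ei Ej /= -kw lw => -> iE.
  by move: ij; rewrite iE eqxx.
rewrite FC; split; first exact: bigcupT_measurable.
rewrite !measure_bigcup//; apply: eq_eseriesr => n _; rewrite /F.
by case: pickle_inv => [k|]; [case: ifP => _|]; rewrite ?measure0.
Qed.

Section poisson_process.
Context {d dE} {T : measurableType d} {E : measurableType dE} {R : realType}.
Local Open Scope ereal_scope.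
Variable Z : nat -> T -> E.
Hypothesis mZ : forall j, measurable_fun setT (Z j).
Local Notation N := (@point_count d dE T E R Z).

Definition count_value (k : option nat) : \bar R :=
  if k is Some n then n%:R%:E else +oo.

Lemma measurable_count_event (A : set E) (B : set (\bar R)) :
  measurable A -> measurable B -> measurable [set w | B (N A w)].
Proof.
move=> mA mB; have := measurable_point_count (R := R) mZ mA.
by move=> /measurable_preimage; exact.
Qed.

Lemma measurable_count_eq (A : set E) (x : \bar R) :
  measurable A -> measurable [set w | N A w = x].
Proof.
by move=> mA; apply: (@measurable_count_event _ [set x]) => //; exact: emeasurable_set1.
Qed.

Lemma point_process_events_measurable :
  point_process_events R Z `<=` measurable.
Proof.
apply: smallest_sub; first exact: sigma_algebra_measurable.
by move=> _ [A [B [mA mB ->]]]; exact: measurable_count_event.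
Qed.

(* The cells of phi are disjoint, so that the independence axiom applies to them
   directly; the price is that closure under intersection needs the common
   refinement of two partitions. *)
Definition count_cylinder : set (set T) := [set V |
  exists (I : finType) (phi : E -> I) (C : set (I -> \bar R)),
    (forall i, measurable (phi @^-1` [set i])) /\
    V = [set w | C (fun i => N (phi @^-1` [set i]) w)]].

Lemma count_cylinder_setI_closed : setI_closed count_cylinder.
Proof.
move=> _ _ [I [phi [C [mphi ->]]]] [J [psi [D [mpsi ->]]]].
exists (I * J)%type, (fun x => (phi x, psi x)).
(* On the product partition, the counts of the coarser cells are recovered as marginal sums. *)
exists [set k | C (fun i => \sum_j k (i, j)) /\ D (fun j => \sum_i k (i, j))].
have pairE i j : (fun x => (phi x, psi x)) @^-1` [set (i, j)] =
    phi @^-1` [set i] `&` psi @^-1` [set j].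
  by apply/seteqP; split => x /= [-> ->].
split; first by case=> i j; rewrite pairE; exact: measurableI.
apply/seteqP; split => w /=;
  (have -> : (fun i => \sum_j N ((fun x => (phi x, psi x)) @^-1` [set (i, j)]) w) =
      (fun i => N (phi @^-1` [set i]) w) by
    apply/funext => i; rewrite (point_count_partition (R := R) Z psi);
    apply: eq_bigr => j _; rewrite pairE);
  (have -> : (fun j => \sum_i N ((fun x => (phi x, psi x)) @^-1` [set (i, j)]) w) =
      (fun j => N (psi @^-1` [set j]) w) by
    apply/funext => j; rewrite (point_count_partition (R := R) Z phi);
    apply: eq_bigr => i _; rewrite pairE setIC); by [].
Qed.

Lemma point_process_events_cylinder :
  point_process_events R Z `<=` <<s count_cylinder >>.
Proof.
apply: smallest_sub; first exact: smallest_sigma_algebra.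
move=> _ [A [B [mA mB ->]]]; apply: sub_sigma_algebra.
(* A single count is a cylinder over the two-cell partition into [A] and its complement. *)
exists bool, (fun x => x \in A), [set k | B (k true)].
have AE : (fun x => x \in A) @^-1` [set true] = A.
  by apply/seteqP; split => x /= xA; [exact/set_mem|exact/mem_set].
split; last by rewrite /= AE.
case; first by rewrite AE.
rewrite (_ : _ @^-1` _ = ~` A); first exact: measurableC.
apply/seteqP; split => x /= xA; first by move=> /mem_set; rewrite xA.
by apply/negbTE/negP => /set_mem.
Qed.

Variables (P P' : probability T R) (mu mu' : set E -> \bar R).
Hypothesis hP : is_poisson_process P Z mu.
Hypothesis hP' : is_poisson_process P' Z mu'.

(** For a finite mean the finite values have equal Poisson weights, and the infinite value is the
    complement of their union. For an infinite mean the count is almost surely infinite. The sign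
    condition excludes the mean [-oo], on which the axioms are silent. *)
Lemma poisson_count_law (A : set E) (k : option nat) :
  measurable A -> 0 <= mu A -> mu A = mu' A ->
  P [set w | N A w = count_value k] = P' [set w | N A w = count_value k].
Proof.
move=> mA; case muA : (mu A) => [r| |//] _ /esym muA'.
  have law n : P [set w | N A w = n%:R%:E] = P' [set w | N A w = n%:R%:E].
    have [/(_ A r n mA muA) -> _ _] := hP.
    by have [/(_ A r n mA muA') -> _ _] := hP'.
  case: k => [n|]; first exact: law.
  have ooE : [set w | N A w = +oo] = ~` \bigcup_n [set w | N A w = n%:R%:E].
    apply/seteqP; split => [w /= woo [n _ /=]|w /= nw]; first by rewrite woo.
    by case: (point_count_nat (R := R) Z A w) => // -[n wn]; case: nw; exists n.
  have mN n : measurable [set w | N A w = n%:R%:E] by exact: measurable_count_eq.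
  have mU := bigcupT_measurable _ mN.
  have tU : trivIset setT (fun n => [set w | N A w = n%:R%:E]).
    move=> i j _ _ [w [/= ->]] [] /eqP.
    by rewrite eqr_nat => /eqP.
  rewrite /= ooE !probability_setC//.
  rewrite !measure_bigcup//.
  by congr (_ - _); apply: eq_eseriesr => n _; exact: law.
have oo : P [set w | N A w = +oo] = 1 by have [_ /(_ A mA muA) -> _] := hP.
have oo' : P' [set w | N A w = +oo] = 1 by have [_ /(_ A mA muA') -> _] := hP'.
case: k => [n|]; last by rewrite /= oo oo'.
have fin0 (Q : probability T R) : Q [set w | N A w = +oo] = 1 ->
    Q [set w | N A w = n%:R%:E] = 0.
  move=> Q1; have mo : measurable [set w | N A w = +oo].
    exact: measurable_count_eq.
  have : Q (~` [set w | N A w = +oo]) = 0 by rewrite probability_setC// Q1 subee.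
  apply: subset_measure0; [exact: measurable_count_eq|exact: measurableC|].
  by move=> w /= ->.
by rewrite /= !fin0.
Qed.

Lemma poisson_count_joint (Q : probability T R) (nu : set E -> \bar R)
    (I : finType) (A : I -> set E) (D : set E) (k : I -> \bar R) (l : \bar R) :
  is_poisson_process Q Z nu ->
  (forall i, measurable (A i)) -> measurable D ->
  trivIset setT A -> (forall i, A i `&` D = set0) ->
  Q ([set w | forall i, N (A i) w = k i] `&` [set w | N D w = l]) =
  \prod_i Q [set w | N (A i) w = k i] * Q [set w | N D w = l].
Proof.
move=> [_ _ indep] mA mD tA AD.
(* Independence is stated for families indexed by ordinals: [D] takes index 0 and the [A i] follow
   in the order of the enumeration of [I]. *)
pose A' (j : 'I_#|I|.+1) := if unlift ord0 j is Some i then A (enum_val i) else D.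
pose B' (j : 'I_#|I|.+1) : set (\bar R) :=
  if unlift ord0 j is Some i then [set k (enum_val i)] else [set l].
have := indep _ A' B'.
rewrite big_ord_recl /A' /B' unlift_none.
under eq_bigr do rewrite liftK.
have -> : \prod_i Q [set w | N (A i) w = k i] =
    \prod_(i < #|I|) Q [set w | N (A (enum_val i)) w = k (enum_val i)].
  by rewrite -(big_enum_val (fun i => Q [set w | N (A i) w = k i])).
rewrite muleC => <-.
- congr (Q _); apply/seteqP; split => [w /= [Ak Dl] j|w /= AB].
    by case: unliftP => [i _|_] //=.
  split; last by have := AB ord0; rewrite unlift_none.
  by move=> i; have := AB (lift ord0 (enum_rank i)); rewrite liftK enum_rankK.
- by move=> j; case: unliftP.
- move=> i j _ _; case: unliftP => [i' ->|->]; case: unliftP => [j' ->|->] //=.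
  + by move=> ij; congr lift; apply: enum_val_inj; exact: tA.
  + by rewrite AD => -[].
  + by rewrite setIC AD => -[].
- by move=> j; case: unliftP => [i _|_]; exact: emeasurable_set1.
Qed.

Lemma point_count_restr (A D : set E) w :
  N D w = 0 -> N A w = N (A `&` ~` D) w.
Proof.
move=> /eqP; rewrite point_count_eq0 => /asboolP wD.
apply: eq_eseriesr => j _; rewrite !diracE; congr (_%:R%:E); congr nat_of_bool.
by apply/idP/idP => /set_mem H; apply/mem_set; [split=> //; exact: wD|case: H].
Qed.

Lemma count_value_inj : injective count_value.
Proof. by move=> [m|] [n|]//= [] /eqP; rewrite eqr_nat => /eqP ->. Qed.

(** A vector of finitely many counts takes countably many values, so a cylinder is a countable union
    of events that prescribe all the counts, and two measures need only be compared on those. *)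
Lemma count_cylinder_fibers (I : finType) (phi : E -> I)
    (C : set (I -> \bar R)) (m m' : {measure set T -> \bar R}) :
  (forall i, measurable (phi @^-1` [set i])) ->
  (forall k : I -> option nat,
    let V := [set w | forall i, N (phi @^-1` [set i]) w = count_value (k i)] in
    m V = m' V) ->
  let U := [set w | C (fun i => N (phi @^-1` [set i]) w)] in
  measurable U /\ m U = m' U.
Proof.
move=> mphi mm' U.
have /choice[cnt cntE] (iw : I * T) : exists k,
    N (phi @^-1` [set iw.1]) iw.2 = count_value k.
  have [[k kE]|kE] := point_count_nat (R := R) Z (phi @^-1` [set iw.1]) iw.2.
    by exists (Some k).
  by exists None.
(* A finite function rather than a plain one, so that the vectors of counts form a countable
   type. *)
pose kappa w := [ffun i => cnt (i, w)].
have kappaE k : kappa @^-1` [set k] =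
    [set w | forall i, N (phi @^-1` [set i]) w = count_value (k i)].
  apply/seteqP; split => w /=; first by move=> <- i; rewrite ffunE (cntE (i, w)).
  move=> wk; apply/ffunP => i; rewrite ffunE; apply: count_value_inj.
  by rewrite -(cntE (i, w)) wk.
have UE : U = kappa @^-1` [set k | C (fun i => count_value (k i))].
  have cE w : (fun i => count_value (kappa w i)) =
      (fun i => N (phi @^-1` [set i]) w).
    by apply/funext => i; rewrite ffunE -(cntE (i, w)).
  by rewrite /U; apply/seteqP; split => w /=; rewrite cE.
rewrite UE; apply: measure_countable_fibers => k; rewrite kappaE; last exact: mm'.
rewrite (_ : [set w | _] = \bigcap_(i in [set: I])
    [set w | N (phi @^-1` [set i]) w = count_value (k i)]).
  apply: fin_bigcap_measurable => [|i _]; first exact: finite_finset.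
  exact: measurable_count_eq.
by apply/seteqP; split => w wk i => [_|]; exact: wk.
Qed.

(* When there is no point in D, every count is a count outside D, where the two
   processes have the same intensity. *)
Lemma poisson_void_proportional (D : set E) :
  measurable D ->
  (forall A, measurable A -> A `&` D = set0 -> 0 <= mu A) ->
  (forall A, measurable A -> A `&` D = set0 -> mu A = mu' A) ->
  P' [set w | N D w = 0] != 0 ->
  exists a : {nonneg R}, forall V, point_process_events R Z V ->
    P (V `&` [set w | N D w = 0]) = a%:num%:E * P' (V `&` [set w | N D w = 0]).
Proof.
move=> mD mu0 mumu' PD0.
set W := [set w | N D w = 0].
have mW : measurable W by exact: measurable_count_eq.
have fineW (Q : probability T R) : (fine (Q W))%:E = Q W.
  by rewrite fineK// fin_num_measure.
(* The counts off [D] are independent of the event [W] and have the same law under [P] and [P'], so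
   the constant has to be the ratio of the void probabilities. *)
have a0 : (0 <= fine (P W) / fine (P' W))%R by rewrite divr_ge0// fine_ge0.
pose a := NngNum a0; exists a => V FV.
pose m := mrestr P mW; pose m' := mscale a (mrestr P' mW).
suff : m V = m' V by [].
apply: (g_sigma_algebra_measure_unique count_cylinder _ (fun=> setT)) => //.
- move=> U [I [phi [C [mphi ->]]]].
  (* [P] is compared with itself: only the measurability half is wanted. *)
  by have [] := @count_cylinder_fibers I phi C P P mphi.
- move=> _; exists unit, (fun=> tt), setT; split; last by apply/seteqP; split.
  by case; rewrite (_ : _ @^-1` _ = setT)//; apply/seteqP; split.
- by rewrite bigcup_const//; exists 0%N.
- exact: count_cylinder_setI_closed.
- move=> U [I [phi [C [mphi ->]]]].
  have [|_ ] := @count_cylinder_fibers I phi C m m' mphi; last exact.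
  move=> k; set V0 := [set w | _].
  change (P (V0 `&` W) = a%:num%:E * P' (V0 `&` W)).
  pose A i := phi @^-1` [set i] `&` ~` D.
  have mA i : measurable (A i) by apply: measurableI => //; exact: measurableC.
  have AD i : A i `&` D = set0 by rewrite /A -setIA setICl setI0.
  have tA : trivIset setT A by move=> i j _ _ [x [[/= <- _] [<- _]]].
  rewrite (_ : V0 `&` W = [set w | forall i, N (A i) w = count_value (k i)] `&` W).
    pose v i := count_value (k i).
    rewrite [LHS](poisson_count_joint v 0 hP mA mD tA AD).
    rewrite [X in _ = _ * X](poisson_count_joint v 0 hP' mA mD tA AD).
    rewrite (eq_bigr (fun i => P' [set w | N (A i) w = count_value (k i)])).
      rewrite muleCA; congr (_ * _).
      rewrite -/W -[P' W]fineW -EFinM divfK ?fineW//.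
      by apply: contra PD0 => /eqP f0; rewrite -fineW f0.
    by move=> i _; apply: poisson_count_law => //; [exact: mu0|exact: mumu'].
  apply/seteqP; split => w [wk wD]; split => // i.
    by rewrite -(wk i) [RHS](@point_count_restr _ D).
  by rewrite [LHS](@point_count_restr _ D) ?wk.
- move=> _; change (P (setT `&` W) < +oo).
  by rewrite setTI (le_lt_trans (probability_le1 _ _))// ltry.
- exact: point_process_events_cylinder.
Qed.

End poisson_process.

(** * Borel sets of the Hoelder ball *)

Section holder_ball_topology.
Context {R : realType} {beta : R} {L : {posnum R}}.
Local Notation ball := (holderBall beta L).
Implicit Types (f g h : ball) (x c : R).

(** Unfolds the initial topology for uniform convergence on [[0, 1]] into balls. The strict bound is
    pointwise, hence slightly weaker than one on the supremum, but yields the same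
    neighbourhoods. *)
Lemma nbhs_holderP f (U : set ball) : nbhs f U <->
  exists2 e, 0 < e & forall h, (forall x, 0 <= x <= 1 -> `|f x - h x| < e) -> U h.
Proof.
split=> [[_ [[W oW <-] Wf WU]]|[e e0 eU]].
  have /uniform_nbhs[V [entV VW]] := open_nbhs_nbhs (conj oW Wf).
  have [e e0 eV] : exists2 e : R, 0 < e & forall a b, `|a - b| < e -> V (a, b).
    move: entV; rewrite -entourage_ballE => -[e /= e0 eV].
    exists e => // a b ab.
    exact: eV.
  exists e => // h fh; apply: WU; apply: VW => x /=.
  by rewrite in_itv /= => x01; apply/eV/fh.
pose E := [set ab : R * R | `|ab.1 - ab.2| < e].
have entE : entourage E by rewrite -entourage_ballE; exists e.
have nE : nbhs (to_uniform f)
    [set h | forall y, `[0, 1]%classic y -> E (to_uniform f y, h y)].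
  by apply/uniform_nbhs; exists E; split.
have : nbhs f (@to_uniform R beta L @^-1`
    [set h | forall y, `[0, 1]%classic y -> E (to_uniform f y, h y)]).
  exact: (@initial_continuous _ _ (@to_uniform R beta L) f _ nE).
apply: filterS.
by move=> h /= fh; apply: eU => x x01; apply: fh; rewrite /= in_itv.
Qed.

Lemma open_holder_lt x c : 0 <= x <= 1 -> open [set f : ball | f x < c].
Proof.
move=> x01; rewrite openE => f /= fc; apply/nbhs_holderP.
exists (c - f x); first by rewrite subr_gt0.
move=> h /(_ x x01); rewrite distrC => /ltr_distlDr.
by rewrite addrC subrK.
Qed.

(** These sets are the supports of the truncation family. *)
Definition holder_ge g : set ball :=
  [set f : ball | forall x, 0 <= x <= 1 -> g x <= f x].

(** The complement is a union over uncountably many points [x]; it is Borel because it is open. *)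
Lemma measurable_holder_ge g : measurable (holder_ge g).
Proof.
rewrite -[holder_ge g]setCK; apply: measurableC; apply: sub_sigma_algebra.
have -> : ~` holder_ge g =
    \bigcup_(x in [set x | 0 <= x <= 1]) [set f : ball | f x < g x].
  apply/seteqP; split => [f /existsNP[x /not_implyP[x01 /negP]]|f [x x01 /= fg]].
    by rewrite -ltNge => fg; exists x.
  by move=> /(_ x x01); rewrite leNgt fg.
by apply: bigcup_open => x; exact: open_holder_lt.
Qed.

Hypothesis hbeta : 0 < beta <= 1.

Lemma holder_scale (e : R) : 0 < e -> exists2 N : nat,
  N.+1%:R^-1 < e & L%:num * N.+1%:R^-1 `^ beta < e.
Proof.
move=> e0; have /andP[b0 b1] := hbeta.
pose delta := (e / (2 * L%:num)) `^ beta^-1.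
have d0 : 0 < delta by apply: powR_gt0; rewrite divr_gt0// mulr_gt0.
have m0 : 0 < Num.min e delta by rewrite lt_min e0.
have [N _ /(_ N (leqnn N)) /=] := near_infty_natSinv_lt (PosNum m0).
rewrite lt_min => /andP[Ne Nd]; exists N => //.
have : N.+1%:R^-1 `^ beta <= delta `^ beta.
  by rewrite ge0_ler_powR ?nnegrE ?(ltW b0) ?(ltW d0) ?(ltW Nd).
rewrite /delta -powRrM mulVf ?gt_eqF// powRr1; last first.
  by rewrite divr_ge0 ?(ltW e0)// mulr_ge0.
rewrite -(ler_pM2l (_ : 0 < L%:num))// => /le_lt_trans; apply.
have -> : L%:num * (e / (2 * L%:num)) = e / 2 by field.
by rewrite ltr_pdivrMr// ltr_pMr// ltr1n.
Qed.

Definition halfspaces : set (set ball) := [set H |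
  exists x c, 0 <= x <= 1 /\ H = [set f : ball | c <= f x]].

(* An open set is the union of the countably many boxes V (N, q), prescribing the
   values at the points i / (N + 1) up to 1 / (N + 1), that it contains: the
   Hoelder condition controls f between these points. *)
Lemma measurable_holderE :
  @measurable _ ball `<=` <<s halfspaces >>.
Proof.
apply: smallest_sub; first exact: smallest_sigma_algebra.
move=> U oU; pose GT : measurableType _ := g_sigma_algebraType halfspaces.
pose V (Nq : nat * seq rat) : set ball :=
  let eta := Nq.1.+1%:R^-1 in
  \bigcap_(i in `I_Nq.1.+2)
    ([set f : ball | ratr Nq.2`_i - eta <= f (i%:R * eta)] `&`
     ~` [set f : ball | ratr Nq.2`_i + eta <= f (i%:R * eta)]).
have mV Nq : @measurable _ GT (V Nq).
  apply: fin_bigcap_measurable => [|i /= iN]; first exact: finite_II.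
  have i01 : 0 <= (i%:R / Nq.1.+1%:R : R) <= 1.
    by rewrite divr_ge0//= ler_pdivrMr// mul1r ler_nat -ltnS.
  have hs c : @measurable _ GT [set f : ball | c <= f (i%:R / Nq.1.+1%:R)].
    by apply: sub_sigma_algebra; exists (i%:R / Nq.1.+1%:R), c.
  by apply: measurableI; [exact: hs|apply: measurableC; exact: hs].
have UE : U = \bigcup_(Nq in [set Nq | V Nq `<=` U]) V Nq.
  apply/seteqP; split => [f Uf|f [Nq /= VU Vf]]; last exact: VU.
  have [e e0 eU] : exists2 e, 0 < e & forall h,
      (forall x, 0 <= x <= 1 -> `|f x - h x| < e) -> U h.
    by apply/nbhs_holderP; exact: open_nbhs_nbhs.
  (* Two moves of less than [e / 4] between [x] and the grid point, one for [f] and one for [h],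
     plus a gap below [2 * eta < e / 2] at the grid point, stay below [e]. *)
  have e40 : 0 < e / 4 by rewrite divr_gt0.
  have [N Ne NLe] := holder_scale e40.
  pose eta : R := N.+1%:R^-1; have eta0 : 0 < eta by rewrite invr_gt0.
  have /choice[q qP] (i : nat) : exists q : rat,
      ratr q - eta <= f (i%:R * eta) < ratr q + eta.
    have : f (i%:R * eta) - eta < f (i%:R * eta) by rewrite ltrBlDr ltrDl.
    move=> /rat_in_itvoo[q]; rewrite in_itv /= => /andP[q1 q2]; exists q.
    by rewrite lerBlDr (ltW (lt_le_trans q2 _)) ?lerDl ?(ltW eta0)//= -ltrBlDr.
  have nq i : (i < N.+2)%N -> (mkseq q N.+2)`_i = q i by exact: nth_mkseq.
  exists (N, mkseq q N.+2); last first.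
    by move=> i /= iN; rewrite nq//; have /andP[q1 q2] := qP i;
      split => //=; apply/negP; rewrite -ltNge.
  move=> h Vh; apply: eU => x /andP[x0 x1].
  (* The grid point [i%:R * eta] is the last one not exceeding [x]; [x = 1] gives [i = N.+1], whence
     [N.+2] grid points. *)
  pose i := Num.truncn (x / eta).
  have xe0 : 0 <= x / eta by rewrite divr_ge0// ltW.
  have /andP[ix xi] := truncn_itv xe0.
  have iN : (i < N.+2)%N.
    rewrite ltnS -(ler_nat R) (le_trans ix)// /eta invrK.
    by rewrite -[leRHS]mul1r ler_wpM2r.
  have ie : i%:R * eta <= x by rewrite -ler_pdivlMr.
  have ie1 : x < i%:R * eta + eta.
    by rewrite -[X in _ + X]mul1r -mulrDl natr1 -ltr_pdivrMr.
  have i01 : 0 <= i%:R * eta <= 1 by rewrite mulr_ge0 ?(ltW eta0)//= (le_trans ie).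
  have x01 : 0 <= x <= 1 by rewrite x0.
  have close (k : ball) : `|holder_fun k x - holder_fun k (i%:R * eta)| < e / 4.
    apply: le_lt_trans (holder_funP k i01 x01) _.
    have le1 : `|x - i%:R * eta| <= N.+1%:R^-1.
      by rewrite ger0_norm ?subr_ge0// lerBlDl ltW.
    apply: le_lt_trans _ NLe; rewrite ler_wpM2l// ge0_ler_powR ?nnegrE//.
    by case/andP: hbeta => /ltW.
  have /andP[qf1 qf2] := qP i.
  have := Vh i iN; rewrite /= -/eta nq// => -[qh1 /negP]; rewrite -ltNge => qh2.
  have := close f; have := close h; rewrite !ltr_distl => /andP[h1 h2] /andP[f1 f2].
  move: Ne; rewrite -/eta => Ne.
  by clearbody eta; apply/andP; split; lra.
rewrite UE bigcup_mkcond; apply: (@countable_bigcupT_measurable _ GT).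
  exact: countableP.
by move=> Nq; case: ifP.
Qed.

Lemma holder_modulus_le x : 0 <= x <= 1 -> L%:num * `|x| `^ beta <= L%:num.
Proof.
move=> /andP[x0 x1]; have p1 : 1 `^ beta = 1 :> R by rewrite powR1.
rewrite ler_piMr// -[leRHS]p1 ge0_ler_powR ?nnegrE ?ger0_norm//.
by case/andP: hbeta => /ltW.
Qed.

Lemma holder_le f x y : 0 <= x <= 1 -> 0 <= y <= 1 ->
  f x <= f y + L%:num * `|y - x| `^ beta.
Proof.
move=> x01 y01; have := holder_funP f x01 y01.
by rewrite ler_distlC => /andP[_]; rewrite addrC.
Qed.

(** Exchanging [x] and [y] turns the one-sided bound into the Hoelder condition; values outside
    [[0, 1]] are reset to 0. *)
Lemma holder_restrict (phi : R -> R) :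
  (forall x y, 0 <= x <= 1 -> 0 <= y <= 1 ->
     phi x <= phi y + L%:num * `|y - x| `^ beta) ->
  exists f, forall x, 0 <= x <= 1 -> f x = phi x.
Proof.
move=> le; pose psi x := if 0 <= x <= 1 then phi x else 0.
have psi_holder x y : 0 <= x <= 1 -> 0 <= y <= 1 ->
    `|psi y - psi x| <= L%:num * `|y - x| `^ beta.
  move=> x01 y01; rewrite /psi x01 y01 ler_distl lerBlDr le//=.
  by rewrite distrC le.
have psi_out x : ~~ (0 <= x <= 1) -> psi x = 0 by rewrite /psi => /negbTE ->.
by exists (HolderBall psi_holder psi_out) => x x01; rewrite /= /psi x01.
Qed.

Lemma holder_ge_setI f g : exists h, holder_ge f `&` holder_ge g = holder_ge h.
Proof.
have [x y x01 y01|h hE] := @holder_restrict (fun x => Num.max (f x) (g x)).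
  by rewrite ge_max !(le_trans (holder_le _ x01 y01))// lerD2r le_max lexx ?orbT.
exists h; apply/seteqP; split => [k [kf kg] x x01|k kh].
  by rewrite hE// ge_max kf// kg.
by split=> x x01; apply: le_trans (kh x x01); rewrite hE// le_max lexx ?orbT.
Qed.

Lemma holder_const c : exists f, forall x, 0 <= x <= 1 -> f x = c.
Proof.
by apply: (@holder_restrict (fun=> c)) => x y _ _; rewrite lerDl mulr_ge0// powR_ge0.
Qed.

Lemma halfspace_holder_ge x c : 0 <= x <= 1 ->
  exists g, [set f : ball | c <= f x] = holder_ge g.
Proof.
move=> x01; have /andP[b0 _] := hbeta.
(* The downward cusp with apex [(x, c)], the least element of the ball with value at least [c] at
   [x], is the opposite of the upward cusp with apex [(x, - c)]. *)
have [y z y01 z01|g gE] := @holder_restrict (fun y => - cusp beta L (x, - c) y).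
  by rewrite lerNl opprD opprK lerBlDr distrC cusp_holder.
have gE' y : 0 <= y <= 1 -> g y = c - L%:num * `|y - x| `^ beta.
  by move=> y01; rewrite gE// /cusp opprD opprK.
exists g; apply/seteqP; split => f /= fc.
  move=> y y01; rewrite gE'// lerBlDr (le_trans fc)// distrC.
  by rewrite distrC holder_le.
apply: le_trans (fc x x01); rewrite gE'// subrr normr0 powR0 ?gt_eqF//.
by rewrite mulr0 subr0.
Qed.

Lemma measurable_holder_geE : @measurable _ ball = <<s range holder_ge >>.
Proof.
apply/seteqP; split.
  apply: subset_trans measurable_holderE _; apply: smallest_sub.
    exact: smallest_sigma_algebra.
  move=> _ [x [c [x01 ->]]]; apply: sub_sigma_algebra.
  by have [g ->] := halfspace_holder_ge c x01; exists g.
apply: smallest_sub; first exact: sigma_algebra_measurable.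
by move=> _ [g _ <-]; exact: measurable_holder_ge.
Qed.

Lemma holder_lower_cover (low : nat -> ball) :
  (forall l x, 0 <= x <= 1 -> low l x = - l%:R) ->
  \bigcup_l holder_ge (low l) = setT.
Proof.
move=> lowE; apply/seteqP; split => // f _.
(* By the Hoelder condition between 0 and [x], [f] is at least [- M] on [[0, 1]]. *)
pose M := `|f 0| + L%:num.
exists (Num.truncn M).+1 => // x x01; rewrite lowE//.
have z01 : 0 <= (0 : R) <= 1 by rewrite lexx ler01.
have := holder_le f z01 x01; rewrite subr0 => f0x.
have x1 := holder_modulus_le x01.
have := truncnS_gt M; rewrite /M => Mlt.
have := ler_norm (- f 0); rewrite normrN => f0.
lra.
Qed.

End holder_ball_topology.

(** * The intensity below the boundary *)

Lemma subset_measure_lty d (T : measurableType d) (R : realType)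
    (m : {measure set T -> \bar R}) (A B : set T) :
  measurable A -> measurable B -> A `<=` B -> (m B < +oo)%E -> (m A < +oo)%E.
Proof. by move=> mA mB AB; apply: le_lt_trans; apply: le_measure; rewrite ?inE. Qed.

Section boundary.
Context {R : realType} {beta : R} {L : {posnum R}}.
Hypothesis hbeta : 0 < beta <= 1.
Local Notation ball := (holderBall beta L).
Implicit Types (f g h : ball) (x c : R).

Definition below g : set (R * R) := [set z | 0 <= z.1 <= 1 /\ z.2 < g z.1].

Lemma holder_continuous (phi : R -> R) :
  (forall x y, `|phi y - phi x| <= L%:num * `|y - x| `^ beta) ->
  continuous phi.
Proof.
move=> phiP x; apply/cvgrPdist_lt => e e0.
have [N Ne NLe] := holder_scale (L := L) hbeta e0.
near=> y.
have xy : `|x - y| <= N.+1%:R^-1 by near: y; exact: cvgr_dist_le.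
apply: le_lt_trans (phiP y x) _; apply: le_lt_trans _ NLe.
by rewrite ler_wpM2l// ge0_ler_powR ?nnegrE//; case/andP: hbeta => /ltW.
Unshelve. all: by end_near. Qed.

(** The extension by 0 may jump at 0 and 1. Composing with the 1-Lipschitz projection onto [[0, 1]]
    gives instead an extension that is Hoelder, hence continuous, on the whole line. *)
Lemma measurable_holder g : exists2 phi : R -> R,
  measurable_fun setT phi & forall x, 0 <= x <= 1 -> g x = phi x.
Proof.
pose clamp x : R := Num.max 0 (Num.min 1 x).
have clamp01 x : 0 <= clamp x <= 1.
  by rewrite /clamp le_max lexx ge_max ler01 ge_min lexx.
have clampE x : 0 <= x <= 1 -> clamp x = x.
  by move=> /andP[x0 x1]; rewrite /clamp min_r// max_r.
have clamp_lip x y : `|clamp y - clamp x| <= `|y - x|.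
  rewrite /clamp /Num.max /Num.min.
  by repeat case: ifPn; rewrite -?leNgt => *; rewrite ler_norml;
    have := ler_norm (y - x); have := ler_norm (- (y - x));
    rewrite normrN => *; apply/andP; split; lra.
exists (g \o clamp); last by move=> x x01; rewrite /= clampE.
apply: continuous_measurable_fun; apply: holder_continuous => x y /=.
apply: le_trans (holder_funP g (clamp01 x) (clamp01 y)) _.
by rewrite ler_wpM2l// ge0_ler_powR ?nnegrE//; case/andP: hbeta => /ltW.
Qed.

Lemma measurable_below g : measurable (below g).
Proof.
have [phi mphi gphi] := measurable_holder g.
have -> : below g = fst @^-1` `[0, 1]%classic `&`
    [set z | (z.2 < phi z.1)%R].
  apply/seteqP; split => -[x y] /=; rewrite in_itv /=.
    by move=> [x01]; rewrite /= gphi.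
  by move=> [x01 xy]; split; rewrite //= gphi.
apply: measurableI; first exact: measurable_preimage.
have mlt : measurable_fun setT (fun z : R * R => z.2 < phi z.1).
  by apply: measurable_fun_ltr => //; exact: measurableT_comp.
by apply: (measurable_preimage (A := [set true]) mlt).
Qed.

Lemma measurable_cusp_lt x c : measurable [set z | cusp beta L z x < c].
Proof.
have mc : measurable_fun setT (fun z : R * R => cusp beta L z x < c).
  apply: measurable_fun_ltr => //; apply: measurable_funD => //.
  apply: measurable_funM => //.
  apply: (@measurableT_comp _ _ _ _ _ _ (fun a => a `^ beta)).
    exact: measurable_powR.
  apply: measurableT_comp => //.
  by apply: measurable_funB.
by apply: (measurable_preimage (A := [set true]) mc).
Qed.

Local Open Scope ereal_scope.
Local Notation mu := (intensity_measure (beta := beta) (L := L)).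

Lemma intensity_measure_ge0 n g A : 0 <= mu n g A.
Proof.
by apply: integral_ge0 => z _; rewrite lee_fin /intensity mulr_ge0.
Qed.

Lemma intensity_measure_below n g : mu n g (below g) = 0.
Proof.
apply: integral0_eq => z [[_ zg] _].
by rewrite /intensity leNgt zg /= mulr0.
Qed.

Lemma eq_intensity_measure n g h A :
  A `&` (below g `|` below h) = set0 -> mu n g A = mu n h A.
Proof.
move=> A0; apply: eq_integral => z /set_mem [Az [/= z01 _]].
have above k : (k = g \/ k = h) -> (k z.1 <= z.2)%R.
  move=> kgh; rewrite leNgt; apply/negP => zk.
  suff : set0 z by [].
  rewrite -A0; split => //; move: z01; rewrite in_itv /= => z01.
  by case: kgh zk => -> zk; [left|right].
by rewrite /intensity !above//; [right|left].
Qed.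

(** The region below [g] carries no intensity; what is left lies above [g] and below [h], in a
    bounded rectangle. This finiteness keeps the void probabilities positive. *)
Lemma intensity_measure_below_lty n g h : mu n g (below g `|` below h) < +oo.
Proof.
pose B := below h `\` below g.
have mB : measurable B by apply: measurableD; exact: measurable_below.
rewrite /intensity_measure integral_mkcond.
rewrite [ltLHS](_ : _ = \int[lebesgue_measure \x lebesgue_measure]_z
    ((cst (n%:R%:E : \bar R)) \_ B) z); last first.
  apply: eq_integral => z _; rewrite !patchE /intensity.
  case: ifPn => [/set_mem [zgh [/= z01 _]]|zN];
    case: ifPn => [/set_mem [hz gz]|nB] //.
  - have -> : (g z.1 <= z.2)%R.
      by rewrite leNgt; apply/negP => ?; apply: gz; case: hz.
    by rewrite mulr1.
  - have -> : (g z.1 <= z.2)%R = false.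
      apply/negbTE; rewrite -ltNge; case: zgh => [[]//|hz].
      rewrite ltNge; apply/negP => gz; move/negP: nB; apply; apply/mem_set.
      by split => // -[_]; rewrite ltNge gz.
    by rewrite mulr0.
  - exfalso; move/negP: zN; apply; apply/mem_set; split; first by right.
    by split => //=; rewrite in_itv /=; case: hz.
rewrite -integral_mkcond integral_cst//.
have [C gC] : exists C : R, forall x, (0 <= x <= 1 -> - C <= g x /\ h x <= C)%R.
  have z01 : (0 <= (0 : R) <= 1)%R by rewrite lexx ler01.
  exists (`|g 0%R| + `|h 0%R| + L%:num)%R => x x01.
  have x1 := holder_modulus_le (L := L) hbeta x01.
  have := holder_le g z01 x01; rewrite subr0 => g0.
  have := holder_le h x01 z01; rewrite sub0r normrN => h0.
  have := ler_norm (- g 0%R)%R; rewrite normrN => g0'.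
  have := ler_norm (h 0%R) => h0'.
  have := normr_ge0 (g 0%R); have := normr_ge0 (h 0%R).
  by split; lra.
have BC : B `<=` `[0%R, 1%R]%classic `*` `[(- C)%R, C]%classic.
  move=> z [[z01 hz] gz]; split; rewrite /= in_itv //=.
  have [gC1 hC] := gC _ z01.
  apply/andP; split; last by rewrite (le_trans (ltW hz)).
  by rewrite (le_trans gC1)// leNgt; apply/negP => zg; exact: gz.
apply: lte_mul_pinfty; [by rewrite lee_fin|by []|].
have mI : measurable (`[0%R, 1%R]%classic `*` `[(- C)%R, C]%classic : set (R * R)).
  exact: measurableX.
apply: subset_measure_lty; [exact: mB|exact: mI|exact: BC|].
rewrite [ltLHS]product_measure1E//= !lebesgue_measure_itv.
by case: ifP => _; case: ifP => _; rewrite -?EFinB ?mul0e ?mule0 -?EFinM ltry.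
Qed.

End boundary.

(** * The maximum likelihood estimator *)

Section boundary_process.
Context {R : realType} {beta : R} {L : {posnum R}}.
Hypothesis hbeta : 0 < beta <= 1.
Local Notation ball := (holderBall beta L).
Implicit Types (f g h : ball) (x c : R).
Context {d : measure_display} {T : measurableType d}.
Variables X Y : nat -> T -> R.
Hypothesis X01 : forall j w, 0 <= X j w <= 1.

Let Z j w : R * R := (X j w, Y j w).
Let ghat w : ball := mle L hbeta (fun j => Z j w).
Local Notation N := (@point_count _ _ T _ R Z).
Local Notation F := (point_process_events R Z).

Lemma void_belowP g w :
  N (below g) w = 0%E <-> forall j, g (X j w) <= Y j w.
Proof.
split=> [/eqP|gY]; first rewrite point_count_eq0 => /asboolP ng j.
  by rewrite leNgt; apply/negP => Yg; apply: (ng j); split=> /=.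
apply/eqP; rewrite point_count_eq0; apply/asboolP => j [_ /=].
by rewrite ltNge gY.
Qed.

(** A Hoelder function lying below the points lies below all their cusps, hence below their infimum;
    conversely [ghat] is at most [Y j w] at the apex [X j w]. The function [g0] bounds the cusps
    from below, so that [inf] is a genuine infimum. *)
Lemma holder_ge_mleP g g0 w : (forall j, g0 (X j w) <= Y j w) ->
  holder_ge g (ghat w) <-> forall j, g (X j w) <= Y j w.
Proof.
have cusp_ge g' x j : 0 <= x <= 1 -> g' (X j w) <= Y j w ->
    g' x <= cusp beta L (Z j w) x.
  move=> x01 gY; have := holder_le g' x01 (X01 j w).
  by rewrite distrC => /le_trans; apply; rewrite lerD2r.
move=> g0Y; split=> [gg j|gY x x01]; last first.
  rewrite /ghat /= /mle_fun x01; apply: lb_le_inf.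
    by exists (cusp beta L (Z 0%N w) x), 0%N.
  by move=> _ [j _ <-]; exact: cusp_ge.
apply: le_trans (gg _ (X01 j w)) _; rewrite /ghat /= /mle_fun X01.
have /andP[b0 _] := hbeta.
have cuspX : cusp beta L (Z j w) (X j w) = Y j w.
  by rewrite /cusp /= subrr normr0 powR0 ?gt_eqF// mulr0 addr0.
rewrite -[leRHS]cuspX; apply: ge_inf; last by exists j.
by exists (g0 (X j w)) => _ [i _ <-]; exact: cusp_ge.
Qed.

Lemma void_event (A : set (R * R)) : measurable A ->
  F [set w | forall j, ~ A (Z j w)].
Proof.
move=> mA; apply: sub_sigma_algebra; exists A, [set 0%E]; split => //.
apply/seteqP; split => w /=.
  by move=> nA; apply/eqP; rewrite point_count_eq0; apply/asboolP.
by move=> /eqP; rewrite point_count_eq0 => /asboolP.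
Qed.

(* Where the cusps are unbounded below (the complement of bdd), mle_fun takes the
   junk value 0, so that ghat x >= c holds there exactly when c <= 0. *)
Lemma mle_is_statistic : is_statistic F ghat.
Proof.
(* [F] is made the sigma-algebra of a measurable type, so that closure properties of measurable sets
   apply to it. *)
pose FT : measurableType _ := g_sigma_algebraType (
  [set V | exists (A : set (R * R)) (B : set (\bar R)),
     [/\ measurable A, measurable B & V = [set w | B (N A w)]]]).
have FTE (V : set T) : @measurable _ FT V = F V by [].
move=> B mB.
have : <<s @halfspaces R beta L >> B by exact: measurable_holderE.
apply: (smallest_sub (X := [set B | F (ghat @^-1` B)])) => /=.
  split.
  - by rewrite /= preimage_set0 -FTE; exact: measurable0.
  - move=> A /= FA; rewrite setTD preimage_setC -FTE; exact: measurableC.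
  - move=> A FA /=; rewrite preimage_bigcup -FTE; exact: bigcupT_measurable.
move=> _ [x [c [x01 ->]]] /=.
have cusp_event m : F [set w | forall j, m <= cusp beta L (Z j w) x].
  rewrite (_ : [set w | _] =
      [set w | forall j, ~ [set z | cusp beta L z x < m] (Z j w)]).
    by apply: void_event; exact: measurable_cusp_lt.
  by apply/seteqP; split => w /= H j; have := H j; rewrite leNgt => /negP.
(* Integer lower bounds suffice, which makes boundedness a countable union of events. *)
pose bdd := \bigcup_k [set w | forall j, - k%:R <= cusp beta L (Z j w) x].
have Fbdd : F bdd.
  by rewrite -FTE; apply: bigcupT_measurable => k; exact: cusp_event.
have bddP w : bdd w <-> has_lbound (range (fun j => cusp beta L (Z j w) x)).
  split=> [[k _ kw]|[m mw]]; first by exists (- k%:R) => _ [j _ <-].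
  exists (Num.truncn (- m)).+1 => // j.
  apply: (@le_trans _ _ m); last by apply: mw; exists j.
  by rewrite lerNl ltW// truncnS_gt.
rewrite (_ : _ @^-1` _ = [set w | forall j, c <= cusp beta L (Z j w) x] `|`
    (if c <= 0 then ~` bdd else set0)).
  rewrite -FTE; apply: measurableU; first exact: cusp_event.
  by case: ifP => _; [apply: measurableC|exact: measurable0].
apply/seteqP; split => w /=; rewrite /mle_fun x01.
  have [/bddP wb|wb] := pselect (bdd w).
    move=> cw; left => j; apply: le_trans cw _.
    by apply: ge_inf => //; exists j.
  rewrite inf_out; last by case=> _ /bddP.
  by move=> c0; right; rewrite c0.
case=> [cw|]; first apply: lb_le_inf.
- by exists (cusp beta L (Z 0%N w) x), 0%N.
- by move=> _ [j _ <-].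
case: ifP => // c0 /= wb; rewrite inf_out//.
by case=> _ /bddP.
Qed.

Hypothesis mX : forall j, measurable_fun setT (X j).
Hypothesis mY : forall j, measurable_fun setT (Y j).
Variables (n : nat) (P : ball -> probability T R).
Hypothesis hP : forall g, is_poisson_process (P g) Z (intensity_measure n g).
Local Open Scope ereal_scope.

Let mZ j : measurable_fun setT (Z j).
Proof. exact: measurable_fun_pair. Qed.

Let void g := [set w | N (below g) w = 0].

Let mvoid g : measurable (void g).
Proof. by apply: measurable_count_eq => //; exact: measurable_below. Qed.

Lemma void_below_full g : P g (~` void g) = 0.
Proof.
rewrite probability_setC//.
have [/(_ (below g) 0%R 0%N (measurable_below hbeta g)) + _ _] := hP g.
rewrite intensity_measure_below => /(_ erefl).
rewrite oppr0 expR0 expr0 fact0 mulr1 divr1 => ->.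
by rewrite subee.
Qed.

(** On [void g] the function [g] itself supplies the lower bound on the cusps, so [holder_ge_mleP]
    applies with [g0 := g]. *)
Lemma void_setI_mle g h :
  ghat @^-1` holder_ge h `&` void g =
  [set w | N (below g `|` below h) w = 0].
Proof.
have voidU w : N (below g `|` below h) w = 0 <-> void g w /\ void h w.
  rewrite /void /=; split=> [/eqP|[/eqP + /eqP]]; rewrite !point_count_eq0.
    move=> /asboolP H; split; apply/eqP; rewrite point_count_eq0;
      apply/asboolP => j ?; apply: (H j); [by left|by right].
  move=> /asboolP Hg /asboolP Hh.
  by apply/eqP; rewrite point_count_eq0; apply/asboolP => j [/Hg|/Hh].
apply/seteqP; split => w /=.
  move=> [hw gw]; apply/voidU; split => //; apply/void_belowP.
  by move/void_belowP: gw => gw; apply/(holder_ge_mleP h gw).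
move=> /voidU[gw hw]; split => //.
by move/void_belowP: gw => gw; apply/(holder_ge_mleP h gw)/void_belowP.
Qed.

Lemma void_below_neq0 g h : P g [set w | N (below g `|` below h) w = 0] != 0.
Proof.
have mu_lty := intensity_measure_below_lty hbeta n g h.
have mu_ge0 := intensity_measure_ge0 n g (below g `|` below h).
have mD : measurable (below g `|` below h).
  by apply: measurableU; exact: measurable_below.
have mu_fin : intensity_measure n g (below g `|` below h) \is a fin_num.
  by rewrite ge0_fin_numE.
have [/(_ _ _ 0%N mD (esym (fineK mu_fin))) -> _ _] := hP g.
by rewrite expr0 fact0 mulr1 divr1 eqe gt_eqF// expR_gt0.
Qed.

Lemma mle_supp_full g : P g (ghat @^-1` ~` holder_ge g) = 0.
Proof.
apply: subset_measure0 (void_below_full g).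
- apply: (point_process_events_measurable (R := R) mZ).
  by apply: mle_is_statistic; apply: measurableC; exact: measurable_holder_ge.
- exact: measurableC.
- move=> w /= nge; apply: contra_not nge => /void_belowP gw.
  exact/(holder_ge_mleP g gw).
Qed.

Lemma boundary_truncation g h : exists a : {nonneg R},
  forall V, F V -> P g (V `&` ghat @^-1` holder_ge h) =
    a%:num%:E * P h (V `&` ghat @^-1` holder_ge g).
Proof.
have mD : measurable (below g `|` below h).
  by apply: measurableU; exact: measurable_below.
have FT := point_process_events_measurable (R := R) mZ.
have mghat B : measurable B -> measurable (ghat @^-1` B).
  by move=> mB; apply: FT; exact: (mle_is_statistic mB).
(* Up to a null set of [P k], truncation by [l] is the absence of points below [k] or [l]. This
   event is symmetric in [k] and [l], so both sides of the claim live on the same void event. *)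
have restrict k l V : F V -> P k (V `&` ghat @^-1` holder_ge l) =
    P k (V `&` [set w | N (below k `|` below l) w = 0]).
  move=> FV; rewrite -void_setI_mle setIA.
  apply: measure_setI_null (mvoid k) _ (void_below_full k).
  by apply: measurableI; [exact: FT|apply: mghat; exact: measurable_holder_ge].
have Ph0 : P h [set w | N (below g `|` below h) w = 0] != 0.
  by rewrite setUC; exact: void_below_neq0.
have [a aE] := poisson_void_proportional mZ (hP g) (hP h) mD
  (fun A _ _ => intensity_measure_ge0 n g A)
  (fun A _ AD => eq_intensity_measure n AD) Ph0.
exists a => V FV; rewrite !restrict// aE//.
by rewrite [X in P h (_ `&` [set w | N X w = 0])]setUC.
Qed.

End boundary_process.

(** * Sufficiency and completeness of the estimator *)

Theorem proposition3p1 (R : realType) (beta : R) (hbeta : 0 < beta <= 1)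
  (L : {posnum R}) (n : nat) (hn : (1 <= n)%N)
  (d : measure_display) (T : measurableType d)
  (X Y : nat -> T -> R)
  (mX : forall j, measurable_fun setT (X j))
  (mY : forall j, measurable_fun setT (Y j))
  (X01 : forall j w, 0 <= X j w <= 1)
  (P : holderBall beta L -> probability T R)
  (hP : forall g : holderBall beta L,
    is_poisson_process (P g) (fun j w => (X j w, Y j w))
      (intensity_measure n g)) :
  let Z : nat -> T -> R * R := fun j w => (X j w, Y j w) in
  let ghat : T -> holderBall beta L :=
    fun w => mle L hbeta (fun j => Z j w) in
  [/\ is_statistic (point_process_events R Z) ghat,
      is_sufficient P (point_process_events R Z) ghat &
      is_complete P ghat].
Proof.
move=> Z ghat.
have mZ j : measurable_fun setT (Z j) by exact: measurable_fun_pair.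
have FT := point_process_events_measurable (R := R) mZ.
have FI : setI_closed (point_process_events R Z).
  move=> A B FA FB.
  exact: (@measurableI _ (g_sigma_algebraType _) A B FA FB).
have stat : is_statistic (point_process_events R Z) ghat.
  exact: mle_is_statistic.
have full := mle_supp_full hbeta X01 mX mY hP.
have trunc := boundary_truncation hbeta X01 mX mY hP.
split=> //.
  (* The constants [- l%:R] have supports that exhaust the ball; [seqDU] makes them disjoint, each
     cell staying inside the support of its own constant. *)
  have /choice[low lowE] (l : nat) :
      exists g : holderBall beta L, forall x, 0 <= x <= 1 -> g x = - l%:R.
    exact: holder_const.
  have mlow l : measurable (holder_ge (low l)) by exact: measurable_holder_ge.
  apply: (truncation_sufficient FT FI stat _ full trunc
    (cell := seqDU (fun l => holder_ge (low l))) (eta := low)).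
  - exact: measurable_holder_ge.
  - by move=> l; apply: measurableD => //; exact: bigsetU_measurable.
  - exact: trivIset_seqDU.
  - by rewrite -seqDU_bigcup_eq; exact: holder_lower_cover.
  - by move=> l; exact: subset_seqDU.
apply: (truncation_complete FT stat _ full trunc).
- exact: measurable_holder_ge.
- exact: holder_ge_setI.
- exact: measurable_holder_geE.
Qed.
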